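(* For every nonnegative integer $k$, there are only finitely many (up to isomorphism) reduced trees having exactly $k$ eigenvalues in the open interval $(-1,1)$ (counted with multiplicity).
   Context: Eigenvalues of a graph are those of its adjacency matrix. For a vertex $v$ of a tree $T$, we say there are $k$ pendant $P_2$ at $v$ if $T-v$ has exactly $k$ connected components isomorphic to the path $P_2$ on two vertices. A tree is reduced if there is no vertex at which it has a pendant $P_2$ (i.e. for no vertex $v$ does $T-v$ have a component isomorphic to $P_2$). *)

(* Defs.v *)
From HB Require Import structures.
From mathcomp Require Import all_boot all_order all_algebra all_field.

Set Implicit Arguments.
Unset Strict Implicit.
Unset Printing Implicit Defensive.

Import Order.TTheory GRing.Theory Num.Theory.

Record sgraph := SGraph {
  vertex :> finType;
  adj : rel vertex;
  adj_sym : symmetric adj;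
  adj_irrefl : irreflexive adj
}.

Definition graph_iso (G H : sgraph) : Prop :=
  exists2 f : G -> H, bijective f & forall x y, adj (f x) (f y) = adj x y.

Section Induced.
Variables (G : sgraph) (A : {set G}).

Definition induced_adj : rel {x : G | x \in A} :=
  fun x y => adj (val x) (val y).

Lemma induced_adj_sym : symmetric induced_adj.
Proof. by move=> x y; apply: adj_sym. Qed.

Lemma induced_adj_irrefl : irreflexive induced_adj.
Proof. by move=> x; apply: adj_irrefl. Qed.

Definition induced : sgraph := SGraph induced_adj_sym induced_adj_irrefl.
End Induced.

Definition del_vertex (G : sgraph) (v : G) : sgraph := induced [set~ v].

Definition components (G : sgraph) : {set {set G}} :=
  equivalence_partition (connect (@adj G)) [set: G].

Section PathGraph.
Variable n : nat.

Definition path_adj : rel 'I_n :=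
  fun i j => (i.+1 == j :> nat) || (j.+1 == i :> nat).

Lemma path_adj_sym : symmetric path_adj.
Proof. by move=> i j; rewrite /path_adj orbC. Qed.

Lemma path_adj_irrefl : irreflexive path_adj.
Proof. by move=> i; rewrite /path_adj orbb gtn_eqF. Qed.

Definition path_graph : sgraph := SGraph path_adj_sym path_adj_irrefl.
End PathGraph.

Definition connected_graph (G : sgraph) : Prop :=
  0 < #|G| /\ forall x y : G, connect (@adj G) x y.

(* [cycle] also accepts x :: y :: nil for an edge xy, whence the size bound. *)
Definition acyclic (G : sgraph) : Prop :=
  forall c : seq G, 2 < size c -> ~ ucycle (@adj G) c.

Definition is_tree (G : sgraph) : Prop := connected_graph G /\ acyclic G.

Definition has_pendant_P2 (G : sgraph) (v : G) : Prop :=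
  exists2 C : {set del_vertex v},
    C \in components (del_vertex v) & graph_iso (induced C) (path_graph 2).

Definition reduced (G : sgraph) : Prop := forall v : G, ~ has_pendant_P2 v.

Local Open Scope ring_scope.

Definition adjacency_mx (G : sgraph) : 'M[algC]_#|G| :=
  \matrix_(i, j) (adj (enum_val i) (enum_val j))%:R.

(* The roots of the characteristic polynomial, repeated according to
   multiplicity. *)
Definition eigenvalues (G : sgraph) : seq algC :=
  sval (closed_field_poly_normal (char_poly (adjacency_mx G))).

(* In the partial order of algC, -1 < x < 1 entails that x is real. *)
Definition num_eigenvalues_open (G : sgraph) (a b : algC) : nat :=
  count (fun x : algC => a < x < b) (eigenvalues G).

Definition finitely_many_upto_iso (P : sgraph -> Prop) : Prop :=
  exists (n : nat) (F : 'I_n -> sgraph),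
    forall G, P G -> exists i, graph_iso G (F i).

(* Main.v *)
(** Let A be the adjacency matrix of T and k the number of its eigenvalues in
    (-1,1). By the spectral theorem, k bounds the number of vectors x with
    |Ax| < |x| such that the supports of the x, and those of the Ax, are
    pairwise disjoint. We call such a vector a gadget.

    Root T. The difference of two leaves with a common neighbour is a gadget
    with Ax = 0, so at most k vertices have two or more leaf children (twin
    supports), and a vertex has at most 2k + 1 leaf children. Because T is
    reduced, the parent of a deepest vertex of a branch that is not a single
    leaf is a twin support. Hence a vertex has at most k children that are not
    leaves. On a path going down from the root, all but at most k disjoint
    blocks of consecutive vertices carry nothing but at most one pendant leaf
    at each vertex, and each of these blocks contains a gadget. So degree and
    depth of T, hence its order, are bounded in terms of k. *)

Require Import Defs.
From mathcomp Require Import all_boot all_order all_algebra all_field.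
From mathcomp Require Import zify.

Set Implicit Arguments.
Unset Strict Implicit.
Unset Printing Implicit Defensive.

Import Order.TTheory GRing.Theory Num.Theory.

(** * Counting eigenvalues in (-1,1) by the spectral theorem *)

Section HermitianEigenvalueCount.
Local Open Scope ring_scope.
Local Open Scope sesquilinear_scope.

Lemma char_poly_invmx_conj (F : fieldType) (n : nat) (P B : 'M[F]_n) :
  P \in unitmx -> char_poly (invmx P *m B *m P) = char_poly B.
Proof.
move=> Pu; rewrite /char_poly.
have -> : char_poly_mx (invmx P *m B *m P) =
    map_mx polyC (invmx P) *m char_poly_mx B *m map_mx polyC P.
  rewrite /char_poly_mx mulmxBr mulmxBl -!map_mxM /=; congr (_ - _).
  by rewrite mul_mx_scalar -scalemxAl -map_mxM mulVmx // map_mx1 scalemx1.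
by rewrite !det_mulmx mulrAC -det_mulmx -map_mxM mulVmx // map_mx1 det1 mul1r.
Qed.

Definition sqnorm (n : nat) (v : 'rV[algC]_n) : algC := \sum_i `|v 0 i| ^+ 2.

Lemma sqnormE n (v : 'rV[algC]_n) : sqnorm v = (v *m v^t*) 0 0.
Proof. by rewrite mxE; apply: eq_bigr => i _; rewrite normCK !mxE. Qed.

Lemma sqnorm_unitary n (v : 'rV[algC]_n) (P : 'M[algC]_n) :
  P \is unitarymx -> sqnorm (v *m P) = sqnorm v.
Proof.
move=> /unitarymxP PP; rewrite !sqnormE trmx_mul map_mxM /= -mulmxA.
by rewrite (mulmxA P) PP mul1mx.
Qed.

(** Unitary similarity to the spectral diagonal keeps the characteristic polynomial, whose
    factorization into linear factors determines the roots with multiplicity. *)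
Lemma count_eigenvalues_diag n (A : 'M[algC]_n) (P : pred algC) :
  A \is hermsymmx ->
  count P (sval (closed_field_poly_normal (char_poly A))) =
  #|[set i | P (spectral_diag A 0 i)]|.
Proof.
move=> Ah; set s := sval _; pose t := [seq spectral_diag A 0 i | i <- enum 'I_n].
suff /permP/(_ P)-> : perm_eq s t.
  rewrite count_map cardE -size_filter enumT; congr size.
  by apply: eq_filter => i; rewrite /= inE.
have charE : char_poly A = \prod_(z <- s) ('X - z%:P).
  have := svalP (closed_field_poly_normal (char_poly A)); rewrite -/s => ->.
  by rewrite (monicP (char_poly_monic A)) scale1r.
have /hermitian_normalmx/orthomx_spectralP A_eq := Ah.
have charD : char_poly A = \prod_(z <- t) ('X - z%:P).
  rewrite {1}A_eq char_poly_invmx_conj ?spectral_unit // char_poly_trig.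
    rewrite big_map big_enum; apply: eq_bigr => i _.
    by rewrite mxE eqxx mulr1n.
  by apply/is_trig_mxP => i j ij; rewrite mxE -val_eqE (ltn_eqF ij) mulr0n.
by apply: prod_XsubC_eq; rewrite -charE.
Qed.

(** Were there fewer than [r] such eigenvalues, some nonzero [w] would make [w *m U] orthogonal to
    all their eigenvectors; on the other eigenvectors [A] acts by factors of modulus at least 1,
    against the hypothesis. *)
Lemma le_count_eigenvalues n r (A : 'M[algC]_n) (U : 'M[algC]_(r, n)) :
  A \is hermsymmx ->
  (forall w : 'rV_r, w != 0 -> sqnorm (w *m U *m A) < sqnorm (w *m U)) ->
  (r <= count (fun x : algC => -1 < x < 1)%R
          (sval (closed_field_poly_normal (char_poly A))))%N.
Proof.
move=> Ah ltU; rewrite count_eigenvalues_diag //; set S := [set i | _].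
rewrite leqNgt; apply/negP => ltSr.
set Q := spectralmx A; have Qu : Q \is unitarymx by apply: spectral_unitarymx.
set D := spectral_diag A.
(* The coordinates of the rows of [U] along the eigenvectors with eigenvalue in (-1,1). *)
pose B := colsub (fun i : 'I_#|S| => enum_val i) (U *m Q^t*).
have /rowV0Pn[w /sub_kermxP wB0 wN0] : kermx B != 0.
  by rewrite kermx_eq0 /row_free neq_ltn (leq_ltn_trans (rank_leq_col _)).
have /lt_geF/negP := ltU w wN0; apply.
have /hermitian_normalmx/orthomx_spectralP A_eq := Ah.
rewrite -/Q -/D invmx_unitary // in A_eq.
set z := w *m U *m Q^t*.
rewrite A_eq !mulmxA -/z sqnorm_unitary //.
have -> : sqnorm (w *m U) = sqnorm z by rewrite sqnorm_unitary // trmxC_unitary.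
apply: ler_sum => i _; rewrite mul_mx_diag [X in _ <= `|X| ^+ 2]mxE normrM exprMn.
have [iS|iNS] := boolP (i \in S).
  suff -> : z 0 i = 0 by rewrite normr0 expr0n mul0r.
  have /matrixP/(_ 0 (enum_rank_in iS i)) := wB0.
  rewrite [RHS]mxE => <-; rewrite /z -mulmxA [LHS]mxE mxE.
  by apply: eq_bigr => j _; congr (_ * _); rewrite [RHS]mxE enum_rankK_in.
rewrite ler_peMr ?exprn_ge0 // exprn_ege1 //.
(* The order of [algC] is partial: not lying in (-1,1) gives modulus at least 1 because the
   eigenvalues are real. *)
have /mxOverP/(_ 0 i) Dreal := hermitian_spectral_diag_real Ah.
by move: iNS; rewrite inE -real_ltr_norml // -real_leNgt ?normr_real ?real1.
Qed.

(** The entry at [v] of A x. Integer vectors suffice for all gadgets. *)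
Definition adj_sum (G : sgraph) (x : G -> int) (v : G) : int :=
  \sum_(w | adj v w) x w.

Lemma adjacency_mx_herm (G : sgraph) : adjacency_mx G \is hermsymmx.
Proof.
apply: realsym_hermsym; last by apply/mxOverP => i j; rewrite mxE realn.
by apply/sesquiP; rewrite expr0 scale1r; apply/matrixP=> i j; rewrite !mxE adj_sym.
Qed.

Lemma adj_sumE (G : sgraph) (x : G -> int) (v : G) :
  (adj_sum x v)%:~R = \sum_j (x (enum_val j))%:~R *
     adjacency_mx G j (enum_rank v) :> algC.
Proof.
rewrite /adj_sum rmorph_sum /= [RHS](reindex (@enum_rank G)) /=; last first.
  by apply: onW_bij; apply: enum_rank_bij.
rewrite big_mkcond; apply: eq_bigr => w _; rewrite mxE !enum_rankK adj_sym.
by case: adj; rewrite ?mulr1 ?mulr0.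
Qed.

(** By disjointness, the squared norms of a combination and of its image under A are sums of those
    of the single vectors, with the same weights [|w i|^2], so the strict inequalities add up. *)
Lemma card_le_num_eigenvalues (G : sgraph) (I : finType) (x : I -> G -> int) :
  (forall i j v, i != j -> x i v * x j v = 0) ->
  (forall i j v, i != j -> adj_sum (x i) v * adj_sum (x j) v = 0) ->
  (forall i, \sum_v adj_sum (x i) v ^+ 2 < \sum_v x i v ^+ 2) ->
  (#|I| <= num_eigenvalues_open G (-1)%R 1%R)%N.
Proof.
move=> xdisj axdisj xlt.
have sqnorm_comb (y : I -> G -> int) (w : 'rV[algC]_#|I|) :
    (forall i j v, i != j -> y i v * y j v = 0) ->
    sqnorm (\row_(k < #|G|) \sum_i w 0 i * (y (enum_val i) (enum_val k))%:~R) =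
    \sum_i `|w 0 i| ^+ 2 * (\sum_v y (enum_val i) v ^+ 2)%:~R.
  move=> ydisj; rewrite /sqnorm.
  under eq_bigr => k _.
    rewrite mxE.
    have -> : `|\sum_i w 0 i * (y (enum_val i) (enum_val k))%:~R| ^+ 2 =
      \sum_i `|w 0 i| ^+ 2 * ((y (enum_val i) (enum_val k)) ^+ 2)%:~R.
      rewrite normCK rmorph_sum big_distrlr /=; apply: eq_bigr => i _.
      rewrite (bigD1 i) //= big1 ?addr0 => [|j ji].
        by rewrite rmorphM rmorph_int mulrACA -normCK -intrM -expr2.
      rewrite rmorphM rmorph_int mulrACA -intrM ydisj ?mulr0 //.
      by rewrite (inj_eq enum_val_inj) eq_sym.
    over.
  rewrite exchange_big; apply: eq_bigr => i _ /=.
  rewrite -mulr_sumr rmorph_sum /=; congr (_ * _).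
  rewrite [LHS](reindex (@enum_rank G)) /=; last first.
    by apply: onW_bij; apply: enum_rank_bij.
  by apply: eq_bigr => v _; rewrite enum_rankK.
pose U : 'M[algC]_(#|I|, #|G|) := \matrix_(i, k) (x (enum_val i) (enum_val k))%:~R.
apply: (@le_count_eigenvalues _ _ _ U); first exact: adjacency_mx_herm.
move=> w wN0.
have -> : w *m U = \row_(k < #|G|) \sum_i w 0 i * (x (enum_val i) (enum_val k))%:~R.
  by apply/rowP => k; rewrite !mxE; apply: eq_bigr => i _; rewrite mxE.
have -> : (\row_(k < #|G|) \sum_i w 0 i * (x (enum_val i) (enum_val k))%:~R)
             *m adjacency_mx G =
   \row_(k < #|G|) \sum_i w 0 i * (adj_sum (x (enum_val i)) (enum_val k))%:~R.
  apply/rowP => k; rewrite [LHS]mxE [RHS]mxE.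
  under [RHS]eq_bigr => i _ do rewrite adj_sumE mulr_sumr enum_valK.
  rewrite exchange_big; apply: eq_bigr => j _ /=; rewrite [in LHS]mxE mulr_suml.
  by apply: eq_bigr => i _; rewrite mulrA.
rewrite (sqnorm_comb (fun i => adj_sum (x i))) // (sqnorm_comb x) //.
have /rV0Pn[i0 wi0] := wN0.
rewrite !(bigD1 i0 (P := xpredT)) //=.
apply: ltr_leD.
  by rewrite ltr_pM2l ?ltr_int // exprn_gt0 // normr_gt0.
by apply: ler_sum => i _; rewrite ler_wpM2l ?exprn_ge0 // ler_int ltW.
Qed.

End HermitianEigenvalueCount.

(** * Rooting a tree: parents and depths *)

Section Rooting.
Local Open Scope nat_scope.

Definition avoiding (G : sgraph) (x : G) : rel G :=
  fun a b => [&& a != x, b != x & adj a b].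

(** A simple path from [y] to [z] off [x] would close up through [x] to a cycle on at least three
    vertices. *)
Lemma acyclic_no_detour (G : sgraph) (x y z : G) :
  acyclic G -> adj x y -> adj x z -> y != z -> ~~ connect (avoiding x) y z.
Proof.
move=> acG xy xz yz; apply/negP => /connectP[q0 q0P zE].
case/shortenP: q0P zE => q qP q_uniq _ zE.
have q_size : 2 < size (x :: y :: q).
  by case: q zE {qP q_uniq} yz => //= ->; rewrite eqxx.
apply: (acG _ q_size).
have adj_q : path (@adj G) y q by apply: sub_path qP => a b /and3P[].
have x_notin : x \notin y :: q.
  rewrite inE negb_or; apply/andP; split.
    by apply: contraTneq xy => ->; rewrite adj_irrefl.
  apply/negP => xq; case/splitPr: xq qP => q1 q2; rewrite cat_path /=.
  by rewrite /avoiding eqxx /= andbF andbF.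
by rewrite /ucycle [cycle _ _]/= rcons_path xy adj_q -zE adj_sym xz /= -/(uniq (y :: q)) x_notin.
Qed.

(* [p] is the parent map, with [p r = r], and [d] the depth. *)
Definition rooting (G : sgraph) (r : G) (p : G -> G) (d : G -> nat) : Prop :=
  [/\ d r = 0, p r = r, forall x, x != r -> d x = (d (p x)).+1 &
      forall x y, adj x y = (x != r) && (p x == y) || (y != r) && (p y == x)].

(** The depth is the distance from [r], and the parent a neighbour of smaller depth. Acyclicity
    leaves no other neighbour of the same or smaller depth, so every edge joins a vertex to its
    parent. *)
Lemma tree_rooting (G : sgraph) (r : G) :
  is_tree G -> exists p d, rooting r p d.
Proof.
move=> [[_ Gconn] acG].
(* [reach n] holds at the ends of walks of length exactly [n] from [r]. *)
pose reach n : pred G :=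
  iter n (fun (P : pred G) x => [exists y, P y && adj y x]) (pred1 r).
have exreach x : exists n, reach n x.
  have /connectP[q qP ->] := Gconn r x.
  elim/last_ind: q qP => [|q y IHq]; first by exists 0 => /=.
  rewrite rcons_path last_rcons => /andP[/IHq[n rn] ay].
  by exists n.+1; apply/existsP; exists (last r q); apply/andP.
pose d x := ex_minn (exreach x).
have dreach x : reach (d x) x by rewrite /d; case: ex_minnP.
have dmin x n : reach n x -> d x <= n by rewrite /d; case: ex_minnP => m _; apply.
have d_r : d r = 0 by apply/eqP; rewrite -leqn0; apply: dmin => /=.
have d_adj x y : adj x y -> d y <= (d x).+1.
  by move=> xy; apply: dmin; apply/existsP; exists x; apply/andP.
have d0 x : d x = 0 -> x = r by move=> dx; have := dreach x; rewrite dx /reach /= => /eqP.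
have exparent x : x != r -> exists y, adj x y && (d y < d x).
  move=> xr; have := dreach x.
  case E : (d x) => [|n]; first by rewrite (d0 x E) eqxx in xr.
  move=> /existsP[y /andP[ry yx]]; exists y.
  by rewrite adj_sym yx ltnS dmin.
pose p x := odflt x [pick y | adj x y && (d y < d x)].
have pP x : x != r -> adj x (p x) /\ d (p x) < d x.
  move=> xr; rewrite /p; case: pickP => [y /andP[]//|none].
  by have [y] := exparent x xr; rewrite none.
have p_r : p r = r by rewrite /p; case: pickP => // y; rewrite d_r andbF.
(* Climbing from [z] strictly lowers the depth, so the climb cannot meet [x], which is at least as
   deep as [z]. *)
have to_root x z : z != x -> d z <= d x -> connect (avoiding x) z r.
  have [n] := ubnP (d z); elim: n z => // n IHn z zn zx dzx.
  have [->//|zr] := eqVneq z r.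
  have [zpz dpz] := pP z zr.
  have pzx : p z != x by apply: contraTneq dpz => ->; rewrite -leqNgt.
  apply: (@connect_trans _ _ (p z)); first by apply: connect1; rewrite /avoiding zx pzx.
  apply: IHn => //; last by apply: leq_trans dzx; apply: ltnW.
  exact: leq_trans dpz _.
have from_root x z : z != x -> d z <= d x -> connect (avoiding x) r z.
  move=> zx dzx; rewrite sym_connect_sym ?to_root // => a b.
  by rewrite /avoiding adj_sym andbCA.
(* Two neighbours of [x], neither deeper than [x], are both joined to [r] off [x]: a detour unless
   they coincide. *)
have parent_uniq x y : adj x y -> d y <= d x -> x != r /\ p x = y.
  move=> xy dyx.
  have yx : y != x by apply: contraTneq xy => ->; rewrite adj_irrefl.
  have xr : x != r.
    by apply: contraNneq yx => xE; move: dyx; rewrite xE d_r leqn0 => /eqP/d0->.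
  have [xpx dpx] := pP x xr; split=> //; apply/eqP; apply: contraT => pxy.
  have /negP[] := acyclic_no_detour acG xpx xy pxy.
  apply: (@connect_trans _ _ r); last exact: from_root.
  apply: to_root; last exact: ltnW.
  by apply: contraTneq dpx => ->; rewrite ltnn.
exists p, d; split=> // [x xr|x y].
  have [xpx dpx] := pP x xr; apply/eqP; rewrite eqn_leq dpx andbT.
  by apply: d_adj; rewrite adj_sym.
apply/idP/orP => [xy|[/andP[xr /eqP<-]|/andP[yr /eqP<-]]]; last 2 first.
- by have [] := pP x xr.
- by rewrite adj_sym; have [] := pP y yr.
case: (leqP (d y) (d x)) => dxy.
  by have [-> ->] := parent_uniq _ _ xy dxy; left; apply/eqP.
rewrite adj_sym in xy.
by have [-> ->] := parent_uniq _ _ xy (ltnW dxy); right; apply/eqP.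
Qed.

End Rooting.

Lemma leq_card_bigcup (I T : finType) (P : pred I) (F : I -> {set T}) :
  #|\bigcup_(i | P i) F i| <= \sum_(i | P i) #|F i|.
Proof.
elim/big_rec2: _ => [|i n A _ le_n]; first by rewrite cards0.
by apply: leq_trans (leq_card_setU _ _) _; rewrite leq_add2l.
Qed.

(** * Ancestors and pendant paths in a rooted tree *)

Section RootedTree.
Local Open Scope nat_scope.
Variables (G : sgraph) (r : G) (p : G -> G) (d : G -> nat).
Hypothesis rootG : rooting r p d.

Definition children (v : G) : {set G} := [set u | (u != r) && (p u == v)].

Definition leaves (v : G) : {set G} := [set u in children v | children u == set0].

Definition twin_support (s : G) : bool := 1 < #|leaves s|.

(** The reflexive ancestor relation, in decidable form. *)
Definition desc (u w : G) : bool := (d u <= d w) && (iter (d w - d u) p w == u).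

Lemma adj_children x y : adj x y = (x \in children y) || (y \in children x).
Proof. by have [_ _ _ ->] := rootG; rewrite !inE. Qed.

Lemma depth_child v u : u \in children v -> d u = (d v).+1.
Proof. by have [_ _ dE _] := rootG; rewrite inE => /andP[/dE-> /eqP->]. Qed.

Lemma depth_iter n x : d (iter n p x) = d x - n.
Proof.
have [dr pr dE _] := rootG; elim: n => [|n IHn] /=; first by rewrite subn0.
have [E|/dE] := eqVneq (iter n p x) r; last by lia.
by move: IHn; rewrite E pr dr; lia.
Qed.

Lemma depth_gt0 x : 0 < d x -> x != r.
Proof. by have [dr _ _ _] := rootG; apply: contraTneq => ->; rewrite dr. Qed.

Lemma desc_refl u : desc u u.
Proof. by rewrite /desc leqnn subnn /=. Qed.

Lemma desc_trans u v w : desc u v -> desc v w -> desc u w.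
Proof.
move=> /andP[uv /eqP uE] /andP[vw /eqP vE]; rewrite /desc (leq_trans uv vw) /=.
rewrite (_ : d w - d u = (d v - d u) + (d w - d v)); last by lia.
by rewrite iterD vE uE.
Qed.

Lemma desc_child v u : u \in children v -> desc v u.
Proof.
move=> uv; rewrite /desc (depth_child uv) leqnSn subSnn /=.
by move: uv; rewrite inE => /andP[].
Qed.

Lemma desc_linear u v w : desc u w -> desc v w -> d u <= d v -> desc u v.
Proof.
move=> /andP[uw /eqP uE] /andP[vw /eqP vE] uv; rewrite /desc uv /=.
rewrite (_ : d w - d u = (d v - d u) + (d w - d v)) in uE; last by lia.
by rewrite iterD vE in uE; apply/eqP.
Qed.

Lemma desc_depth_eq u v : desc u v -> d u = d v -> u = v.
Proof. by move=> /andP[_ /eqP uE] duv; move: uE; rewrite duv subnn. Qed.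

Lemma desc_inj u v w : desc u w -> desc v w -> d u = d v -> u = v.
Proof.
by move=> uw vw duv; apply: desc_depth_eq => //; apply: desc_linear uw vw _; rewrite duv.
Qed.

(** Deleting [t] isolates the edge between [s] and [w]: the other neighbour of [s] is its parent
    [t], and [w] has no neighbour but [s]. *)
Lemma pendant_P2 t s w :
  s \in children t -> children s = [set w] -> children w = set0 ->
  has_pendant_P2 t.
Proof.
move=> st sE wE.
have ws : w \in children s by rewrite sE set11.
have dst := depth_child st; have dws := depth_child ws.
have st' : s \in [set~ t] by rewrite !inE; apply: contraTneq isT => E; move: dst; rewrite E; lia.
have wt' : w \in [set~ t] by rewrite !inE; apply: contraTneq isT => E; move: dst; rewrite -E; lia.
have sw : s != w by apply: contraTneq isT => E; move: dws; rewrite E; lia.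
have wsF : (w == s) = false by rewrite eq_sym (negbTE sw).
have asw : adj s w by rewrite adj_children ws orbT.
have aws : adj w s by rewrite adj_sym.
pose S : del_vertex t := Sub s st'; pose W : del_vertex t := Sub w wt'.
pose C := [set y in [set: del_vertex t] | connect (@adj (del_vertex t)) S y].
have CE y : (y \in C) = (val y == s) || (val y == w).
  rewrite !inE /=; apply/idP/orP => [Sy|[/eqP E|/eqP E]]; last 2 first.
  - by rewrite (_ : y = S) //; apply: val_inj.
  - by rewrite (_ : y = W); [apply: connect1 | apply: val_inj].
  pose a := [pred y : del_vertex t | (val y == s) || (val y == w)].
  have /closed_connect/(_ _ _ Sy) : closed (@adj (del_vertex t)) a.
    apply: intro_closed; first by apply: sym_connect_sym; apply: adj_sym.
    move=> x z xz; rewrite !inE => /orP[/eqP xE|/eqP xE].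
      have : adj s (val z) by rewrite -xE.
      rewrite adj_children sE inE => /orP[|->]; last by rewrite orbT.
      move=> sz; have : val z != t by have := valP z; rewrite !inE.
      by move: sz st; rewrite !inE => /andP[_ /eqP<-] /andP[_ /eqP->]; rewrite eqxx.
    have : adj w (val z) by rewrite -xE.
    rewrite adj_children wE in_set0 orbF => wz.
    by move: wz ws; rewrite !inE => /andP[_ /eqP<-] /andP[_ /eqP->]; rewrite eqxx.
  by rewrite !inE /= eqxx /= => /esym/orP.
exists C; first by apply/imsetP; exists S.
have SC : S \in C by rewrite CE eqxx.
have WC : W \in C by rewrite CE eqxx orbT.
pose f (y : induced C) : path_graph 2 := if val (val y) == s then ord0 else ord_max.
pose g (i : path_graph 2) : induced C := if i == ord0 then Sub S SC else Sub W WC.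
exists f.
  exists g => [y|i]; rewrite /f /g.
    have := CE (val y); rewrite (valP y) => /esym.
    case: eqP => [yE _|_ /= /eqP yE] /=; do 2 apply: val_inj => /=; by rewrite yE.
  have [->|] := eqVneq i ord0; first by rewrite /= eqxx.
  by rewrite /= wsF; case: i => [[|[|]]] //= ? _; apply: val_inj.
move=> x y; have := CE (val x); have := CE (val y); rewrite (valP x) (valP y).
move=> /esym yE /esym xE; rewrite /f.
have -> : adj x y = adj (val (val x)) (val (val y)) by [].
case/orP: xE => /eqP->; case/orP: yE => /eqP->;
  by rewrite ?eqxx ?wsF ?asw ?aws ?(@adj_irrefl G).
Qed.

(** Let [w] be deepest below [u]. All children of its parent are leaves; were [w] the only one, it
    would form with its parent a pendant P2 at the grandparent, which exists because [u], being a
    child, is not the root. *)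
Lemma branch_twin_support v u :
  reduced G -> u \in children v -> u \notin leaves v ->
  exists2 s, twin_support s & desc u s.
Proof.
move=> redG uv; rewrite inE uv /= => /set0Pn[c cu].
have [w uw wmax] := arg_maxnP d (desc_refl u).
have duw : d u < d w.
  by have := wmax c (desc_child cu); rewrite (depth_child cu).
have wc : w \in children (p w) by rewrite inE eqxx depth_gt0 //; lia.
have dw := depth_child wc.
have us : desc u (p w) by apply: desc_linear uw (desc_child wc) _; lia.
have s_leaves : leaves (p w) = children (p w).
  apply/setP => x; rewrite inE; case xs: (x \in children (p w)) => //=.
  apply/set0Pn => -[y yx].
  have := wmax y (desc_trans (desc_trans us (desc_child xs)) (desc_child yx)).
  rewrite /= (depth_child yx) (depth_child xs); lia.
have wleaf : children w = set0.
  by apply/eqP; move: wc; rewrite -s_leaves inE => /andP[].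
exists (p w) => //; rewrite /twin_support ltnNge; apply/negP => le1.
have sE : children (p w) = [set w].
  apply/eqP; rewrite eq_sym eqEcard sub1set wc cards1 -s_leaves le1 //.
have st : p w \in children (p (p w)).
  by rewrite inE eqxx depth_gt0 //; have := depth_child uv; lia.
exact: redG (pendant_P2 st sE wleaf).
Qed.


(** * Twin leaves, twin supports and the bound on the number of children *)

Local Notation m := (num_eigenvalues_open G (-1)%R 1%R).

Definition delta (a v : G) : int := ((v == a)%:R)%R.

Lemma adj_sum_delta (a v : G) : adj_sum (delta a) v = ((adj v a)%:R)%R.
Proof.
rewrite /adj_sum /delta big_mkcond (bigD1 a) //= eqxx big1 => [|w wa].
  by case: adj; rewrite ?addr0.
by rewrite (negbTE wa); case: adj.
Qed.

Lemma sum_delta_mul (a : G) (f : G -> int) : (\sum_v delta a v * f v = f a)%R.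
Proof.
rewrite (bigD1 a) //= /delta eqxx mul1r big1 ?addr0 // => w wa.
by rewrite (negbTE wa) mul0r.
Qed.

Lemma adj_leaf s u v : u \in leaves s -> adj v u = (v == s).
Proof.
rewrite inE => /andP[us /eqP u0]; rewrite adj_children u0 in_set0 /=.
by move: us; rewrite !inE => /andP[-> /eqP->]; rewrite eq_sym.
Qed.

(** Since [s i] is the only neighbour of [a i] and of [b i], A annihilates the difference of the
    two. The [s i] may coincide. *)
Lemma card_twin_pairs (I : finType) (s a b : I -> G) :
  (forall i, a i \in leaves (s i)) -> (forall i, b i \in leaves (s i)) ->
  (forall i, a i != b i) ->
  (forall i j, i != j -> [/\ a i != a j, a i != b j & b i != b j]) -> #|I| <= m.
Proof.
move=> al bl ab disj.
pose x i v := (delta (a i) v - delta (b i) v)%R.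
have x0 i v : adj_sum (x i) v = 0%R.
  have -> : adj_sum (x i) v = (adj_sum (delta (a i)) v - adj_sum (delta (b i)) v)%R.
    by rewrite /adj_sum -sumrB.
  by rewrite !adj_sum_delta (adj_leaf _ (al i)) (adj_leaf _ (bl i)) subrr.
apply: (@card_le_num_eigenvalues _ _ x) => [i j v ij|i j v _|i]; last 2 first.
- by rewrite x0 mul0r.
- rewrite big1 => [|v _]; last by rewrite x0 expr0n.
  rewrite (bigD1 (a i)) //= ltr_pwDl ?sumr_ge0 // => [|v _]; last exact: sqr_ge0.
  by rewrite /x /delta eqxx (negbTE (ab i)).
have [/negbTE aa /negbTE ab' /negbTE bb] := disj i j ij.
have [_ /negbTE ba _] : [/\ a j != a i, a j != b i & b j != b i].
  by apply: disj; rewrite eq_sym.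
rewrite /x /delta; case: (eqVneq v (a i)) => [->|_].
  by rewrite aa ab' subrr mulr0.
case: (eqVneq v (b i)) => [->|_]; last by rewrite subrr mul0r.
by rewrite (eq_sym _ (a j)) ba bb subrr mulr0.
Qed.

(** Otherwise the first 2m + 2 leaves split into m + 1 disjoint consecutive pairs. *)
Lemma card_leaves s : #|leaves s| <= m.*2.+1.
Proof.
rewrite leqNgt; apply/negP => lt; set e := enum (leaves s).
have sz : m.*2.+1 < size e by rewrite -cardE.
have nthl k : k < size e -> nth r e k \in leaves s.
  by move=> /(mem_nth r); rewrite mem_enum.
have nthE k l : k < size e -> l < size e -> (nth r e k == nth r e l) = (k == l).
  by move=> kl ll; rewrite nth_uniq // enum_uniq.
suff: #|'I_m.+1| <= m by rewrite card_ord ltnn.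
apply: (@card_twin_pairs _ (fun=> s) (fun i : 'I_m.+1 => nth r e i.*2)
                                     (fun i => nth r e i.*2.+1)).
- by move=> i; apply: nthl; have := ltn_ord i; lia.
- by move=> i; apply: nthl; have := ltn_ord i; lia.
- by move=> i; have ? := ltn_ord i; rewrite nthE; lia.
- by move=> i j; rewrite -val_eqE /= => ij; have := ltn_ord i; have := ltn_ord j => ? ?;
  rewrite !nthE; try lia; split; lia.
Qed.

(** Each twin support contributes its first two leaves; these pairs are disjoint since a leaf
    determines its parent. *)
Lemma card_twin_support : #|[set s | twin_support s]| <= m.
Proof.
pose I : finType := {s : G | twin_support s}.
have nthl (i : I) k : k < 2 -> nth r (enum (leaves (val i))) k \in leaves (val i).
  move=> k2; rewrite -mem_enum mem_nth // -cardE.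
  by apply: leq_trans k2 _; apply: (valP i).
have parent s u : u \in leaves s -> p u = s by rewrite !inE => /andP[/andP[_ /eqP]].
rewrite cardsE -card_sig -/I.
apply: (@card_twin_pairs _ (fun i : I => val i)
   (fun i => nth r (enum (leaves (val i))) 0)
   (fun i => nth r (enum (leaves (val i))) 1)).
- by move=> i; apply: nthl.
- by move=> i; apply: nthl.
- move=> i; have lt1 : 1 < size (enum (leaves (val i))) by rewrite -cardE; apply: (valP i).
  by rewrite nth_uniq ?enum_uniq // ltnW.
- move=> i j ij; split; apply: contraNneq ij => E; apply/eqP/val_inj.
  + by rewrite -(parent _ _ (nthl i 0 isT)) E (parent _ _ (nthl j 0 isT)).
  + by rewrite -(parent _ _ (nthl i 0 isT)) E (parent _ _ (nthl j 1 isT)).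
  + by rewrite -(parent _ _ (nthl i 1 isT)) E (parent _ _ (nthl j 1 isT)).
Qed.

(** At most 2m + 1 children are leaves. Each other child has a twin support below it, and siblings,
    being of equal depth, have no common descendant. *)
Lemma card_children v : reduced G -> #|children v| <= 3 * m + 1.
Proof.
move=> redG; rewrite -(cardsID (leaves v)).
have I1 : #|children v :&: leaves v| <= m.*2.+1.
  by apply: leq_trans (card_leaves v); apply: subset_leq_card; apply: subsetIr.
suff: #|children v :\: leaves v| <= m by lia.
apply: leq_trans card_twin_support.
pose f u := odflt r [pick s | twin_support s && desc u s].
have fP u : u \in children v :\: leaves v -> twin_support (f u) && desc u (f u).
  rewrite inE => /andP[ul uv]; rewrite /f; case: pickP => // none.
  by have [s ts us] := branch_twin_support redG uv ul; have := none s; rewrite ts us.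
have f_inj : {in children v :\: leaves v &, injective f}.
  move=> u u' uA uA' E; have /andP[_ du] := fP u uA; have /andP[_ du'] := fP u' uA'.
  rewrite -E in du'; apply: desc_inj du du' _.
  move: uA uA'; rewrite !in_setD => /andP[_ uv] /andP[_ uv'].
  by rewrite (depth_child uv) (depth_child uv').
rewrite -(card_in_imset f_inj); apply: subset_leq_card.
by apply/subsetP => _ /imsetP[u uA ->]; rewrite inE; case/andP: (fP u uA).
Qed.

(** * Gadgets along a path from the root, and the bound on the depth *)

Section LongPath.
Variables (w : G) (redG : reduced G).

(* The ancestor of [w] at depth [i], and its children off the path to [w]. *)
Let a i := iter (d w - i) p w.
Let off i := children (a i) :\ a i.+1.

Lemma ancestor_depth i : i <= d w -> d (a i) = i.
Proof. by rewrite depth_iter; lia. Qed.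

Lemma ancestor_child i : i < d w -> a i.+1 \in children (a i).
Proof.
move=> iw; rewrite inE depth_gt0 ?ancestor_depth //= /a.
by rewrite (_ : d w - i = (d w - i.+1).+1) //; lia.
Qed.

Lemma ancestor_desc i j : i <= j <= d w -> desc (a i) (a j).
Proof.
move=> ij; rewrite /desc !ancestor_depth; try lia.
by rewrite /a -iterD; apply/andP; split; last apply/eqP; try congr iter; lia.
Qed.

(** The three kinds of neighbour exclude one another, so their indicators add up. The bounds on [i]
    keep [a i] away from the ends, where a neighbour on the path is missing. *)
Lemma adj_ancestor i v : 0 < i < d w ->
  ((adj v (a i))%:R = delta (a i.-1) v + delta (a i.+1) v + (v \in off i)%:R)%R.
Proof.
case: i => // i iw; rewrite adj_children orbC.
have up : (a i.+1 \in children v) = (v == a i).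
  have := ancestor_child (ltnW iw); rewrite !inE => /andP[-> /eqP->].
  exact: eq_sym.
rewrite up /= /off in_setD1 /delta.
have down : a i.+2 \in children (a i.+1) by apply: ancestor_child; lia.
have [->|vd] := eqVneq v (a i.+2); rewrite ?down /=.
  have /negbTE-> // : a i.+2 != a i.
  by apply: contraTneq isT => /(congr1 d); rewrite !ancestor_depth; lia.
have [->|va] := eqVneq v (a i); last by rewrite addr0 add0r.
have /negbTE-> // : a i \notin children (a i.+1).
by apply/negP => /depth_child; rewrite !ancestor_depth; lia.
Qed.

Lemma off_depth i v : i <= d w -> v \in off i -> d v = i.+1.
Proof. by rewrite in_setD1 => iw /andP[_ /depth_child->]; rewrite ancestor_depth. Qed.

(* Some twin support branches off the path at a depth in [[lo, hi)]. *)
Definition bad_block lo hi :=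
  [exists s, [&& twin_support s, desc (a lo) s & ~~ desc (a hi) s]].

(** An off-path child that is not a leaf would have a twin support below it, and two off-path leaf
    children would make [a i] itself one. Either would branch off inside the block. *)
Lemma good_off lo hi i : lo <= i < hi -> hi <= d w -> ~~ bad_block lo hi ->
  off i \subset leaves (a i) /\ #|off i| <= 1.
Proof.
move=> loi hiw good.
have notin s : twin_support s -> desc (a i) s -> desc (a i.+1) s.
  move=> ts is_; apply: contraNT good => nis; apply/existsP; exists s; rewrite ts /=.
  apply/andP; split; first by apply: desc_trans is_; apply: ancestor_desc; lia.
  by apply: contra nis => /(desc_trans _)-> //; apply: ancestor_desc; lia.
have off_leaves : off i \subset leaves (a i).
  apply/subsetP => u; rewrite in_setD1 => /andP[ua uc]; apply: contraT => ul.
  have [s ts us] := branch_twin_support redG uc ul.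
  have as_ := notin s ts (desc_trans (desc_child uc) us).
  case/eqP: ua; apply: desc_inj us as_ _.
  by rewrite (depth_child uc) !ancestor_depth; lia.
split=> //; rewrite leqNgt; apply/negP => lt1.
have /notin/(_ (desc_refl _))/andP[] : twin_support (a i).
  by apply: leq_trans lt1 _; apply: subset_leq_card.
by rewrite !ancestor_depth; lia.
Qed.

(* The bounds on the depth keep the gadgets of different blocks disjoint. *)
Definition local_gadget lo hi (x : G -> int) :=
  [/\ forall v, x v != 0%R -> lo <= d v <= hi,
      forall v, adj_sum x v != 0%R -> lo <= d v <= hi &
      (\sum_v adj_sum x v ^+ 2 < \sum_v x v ^+ 2)%R].

Lemma delta_neq0 u v : delta u v != 0%R -> v = u.
Proof. by rewrite /delta; case: (eqVneq v u). Qed.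

(* The gadget takes the value 2 at the leaf [u] and -1 at the two path
   neighbours of its parent [a e], where A x then vanishes. *)
Lemma leaf_gadget e u : 1 < e -> e.+1 < d w ->
  u \in off e -> off e \subset leaves (a e) ->
  #|off e.-1| <= 1 -> #|off e.+1| <= 1 ->
  exists x, local_gadget (e - 2) (e + 2) x.
Proof.
move=> e1 ew ue /subsetP/(_ u ue) ul c1 c2.
pose x v := (2 * delta u v - delta (a e.-1) v - delta (a e.+1) v)%R.
(* This is -A x: what survives are the outer path neighbours and the off-path children of [a e.-1]
   and [a e.+1]. *)
pose y v := (delta (a e.-2) v + delta (a e.+2) v + (v \in off e.-1)%:R
              + (v \in off e.+1)%:R)%R : int.
have axE v : adj_sum x v = (- y v)%R.
  have -> : adj_sum x v = (2 * adj_sum (delta u) v - adj_sum (delta (a e.-1)) v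
                            - adj_sum (delta (a e.+1)) v)%R.
    by rewrite /adj_sum /x !sumrB mulr_sumr.
  rewrite !adj_sum_delta (adj_leaf _ ul) !adj_ancestor; try lia.
  by rewrite /y /= prednK; [rewrite -/(delta (a e) v); lia | lia].
have du : d u = e.+1 by apply: off_depth ue; lia.
have ua : (u == a e.+1) = false by move: ue; rewrite in_setD1 => /andP[/negbTE].
have neq v v' : d v != d v' -> (v == v') = false.
  by move=> dd; apply: contraNF dd => /eqP->.
have sumx : (\sum_v x v ^+ 2 = 6)%R.
  have -> : (\sum_v x v ^+ 2 = 2 * x u - x (a e.-1) - x (a e.+1))%R.
    rewrite -!(sum_delta_mul _ x) mulr_sumr -!sumrB; apply: eq_bigr => v _.
    by rewrite expr2 {1}/x !mulrBl mulrA.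
  have ub : (u == a e.-1) = false by rewrite neq // du ancestor_depth; lia.
  have cb : (a e.+1 == a e.-1) = false by rewrite neq // !ancestor_depth; lia.
  rewrite /x /delta !eqxx [a e.-1 == u]eq_sym [a e.+1 == u]eq_sym.
  by rewrite [a e.-1 == a e.+1]eq_sym ua ub cb.
exists x; split.
- move=> v; rewrite /x.
  have [/delta_neq0->|/negPn/eqP->] := boolP (delta u v != 0%R); first by rewrite du; lia.
  have [/delta_neq0->|/negPn/eqP->] := boolP (delta (a e.-1) v != 0%R).
    by rewrite ancestor_depth; lia.
  have [/delta_neq0->|/negPn/eqP->] := boolP (delta (a e.+1) v != 0%R); last by [].
  by rewrite ancestor_depth; lia.
- move=> v; rewrite axE /y.
  have [/delta_neq0->|/negPn/eqP->] := boolP (delta (a e.-2) v != 0%R).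
    by rewrite ancestor_depth; lia.
  have [/delta_neq0->|/negPn/eqP->] := boolP (delta (a e.+2) v != 0%R).
    by rewrite ancestor_depth; lia.
  have [/off_depth->|_] := boolP (v \in off e.-1); try lia.
  have [/off_depth->|_] := boolP (v \in off e.+1); lia.
(* [y] takes only the values 0 and 1, the latter at most four times: at two path vertices and at
   most one vertex of each of the two [off] sets. *)
rewrite sumx; apply: (@Order.POrderTheory.le_lt_trans _ _ 4%R) => //.
have y01 v : (y v ^+ 2 = y v)%R.
  rewrite /y /delta.
  have [->|_] := eqVneq v (a e.-2).
    rewrite neq ?ancestor_depth; try lia.
    have /negbTE-> : a e.-2 \notin off e.-1.
      by apply/negP => /off_depth; rewrite ancestor_depth; lia.
    have /negbTE-> // : a e.-2 \notin off e.+1.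
    by apply/negP => /off_depth; rewrite ancestor_depth; lia.
  have [->|_] := eqVneq v (a e.+2).
    have /negbTE-> : a e.+2 \notin off e.-1.
      by apply/negP => /off_depth; rewrite ancestor_depth; lia.
    by rewrite /off in_setD1 eqxx.
  have [v1|_] := boolP (v \in off e.-1).
    have /negbTE-> // : v \notin off e.+1.
    by apply/negP => /off_depth; move: v1 => /off_depth->; lia.
  by case: (v \in off e.+1).
under eq_bigr => v _ do rewrite axE sqrrN y01.
have sum_mem (A : {set G}) : (\sum_v (v \in A)%:R = #|A|%:R :> int)%R.
  by rewrite -sum1_card natr_sum [RHS]big_mkcond; apply: eq_bigr => v _; case: (v \in A).
have sum_delta u' : (\sum_v delta u' v = 1 :> int)%R.
  by rewrite -[RHS](sum_delta_mul u' (fun=> 1%R)); apply: eq_bigr => v _; rewrite mulr1.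
rewrite /y !big_split /= !sum_delta !sum_mem; lia.
Qed.

(* The gadget takes the values 1, -1, 1 at depths [e - 2], [e], [e + 2]. *)
Lemma path_gadget e : 2 < e -> e.+2 < d w ->
  off e.-2 = set0 -> off e = set0 -> off e.+2 = set0 ->
  exists x, local_gadget (e - 3) (e + 3) x.
Proof.
move=> e1 ew o1 o2 o3.
pose x v := (delta (a e.-2) v - delta (a e) v + delta (a e.+2) v)%R.
(* This is A x: neighbouring values cancel at depths [e - 1] and [e + 1], and only the ends at
   [e - 3] and [e + 3] remain. *)
pose y v := (delta (a e.-2.-1) v + delta (a e.+3) v)%R : int.
have axE v : adj_sum x v = (y v)%R.
  have -> : adj_sum x v = (adj_sum (delta (a e.-2)) v - adj_sum (delta (a e)) v
                            + adj_sum (delta (a e.+2)) v)%R.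
    by rewrite /adj_sum /x big_split /= sumrB.
  rewrite !adj_sum_delta !adj_ancestor; try lia.
  rewrite o1 o2 o3 !in_set0 /y (_ : e.-2.+1 = e.-1) /=; lia.
have neq v v' : d v != d v' -> (v == v') = false.
  by move=> dd; apply: contraNF dd => /eqP->.
have sumx : (\sum_v x v ^+ 2 = 3)%R.
  have -> : (\sum_v x v ^+ 2 = x (a e.-2) - x (a e) + x (a e.+2))%R.
    rewrite -!(sum_delta_mul _ x) -sumrB -big_split; apply: eq_bigr => v _ /=.
    by rewrite expr2 {1}/x mulrDl mulrBl.
  by rewrite /x /delta !eqxx !neq ?ancestor_depth //; lia.
have sumy : (\sum_v y v ^+ 2 = 2)%R.
  have -> : (\sum_v y v ^+ 2 = y (a e.-2.-1) + y (a e.+3))%R.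
    rewrite -!(sum_delta_mul _ y) -big_split; apply: eq_bigr => v _ /=.
    by rewrite expr2 {1}/y mulrDl.
  by rewrite /y /delta !eqxx !neq ?ancestor_depth //; lia.
exists x; split.
- move=> v; rewrite /x.
  have [/delta_neq0->|/negPn/eqP->] := boolP (delta (a e.-2) v != 0%R).
    by rewrite ancestor_depth; lia.
  have [/delta_neq0->|/negPn/eqP->] := boolP (delta (a e) v != 0%R).
    by rewrite ancestor_depth; lia.
  have [/delta_neq0->|/negPn/eqP->] := boolP (delta (a e.+2) v != 0%R); last by [].
  by rewrite ancestor_depth; lia.
- move=> v; rewrite axE /y.
  have [/delta_neq0->|/negPn/eqP->] := boolP (delta (a e.-2.-1) v != 0%R).
    by rewrite ancestor_depth; lia.
  have [/delta_neq0->|/negPn/eqP->] := boolP (delta (a e.+3) v != 0%R); last by [].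
  by rewrite ancestor_depth; lia.
by under eq_bigr => v _ do rewrite axE; rewrite sumx sumy.
Qed.

Lemma local_gadget_widen lo hi lo' hi' x :
  lo' <= lo -> hi <= hi' -> local_gadget lo hi x -> local_gadget lo' hi' x.
Proof.
by move=> ll hh [xs axs lt]; split=> // v => [/xs|/axs]; lia.
Qed.

(** If [off] is nonempty at depth [b + 2], [b + 4] or [b + 6], the leaf gadget centred there stays
    within the block; otherwise the path gadget centred at [b + 4] applies. *)
Lemma block_gadget b : b + 8 <= d w -> ~~ bad_block b.+1 (b + 8) ->
  exists x, local_gadget b (b + 8) x.
Proof.
move=> bw good.
have offP i : b.+1 <= i < b + 8 -> off i \subset leaves (a i) /\ #|off i| <= 1.
  by move=> ib; apply: good_off good.
have at_leaf e : b.+2 <= e < b + 7 -> off e != set0 ->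
    exists x, local_gadget b (b + 8) x.
  move=> eb /set0Pn[u ue].
  have [|oe _] := offP e; first by lia.
  have [|_ oe1] := offP e.-1; first by lia.
  have [|_ oe2] := offP e.+1; first by lia.
  have [||x xP] := leaf_gadget _ _ ue oe oe1 oe2; try lia.
  by exists x; apply: local_gadget_widen xP; lia.
have [o1|] := eqVneq (off (b + 4).-2) set0; last by apply: at_leaf; lia.
have [o2|] := eqVneq (off (b + 4)) set0; last by apply: at_leaf; lia.
have [o3|] := eqVneq (off (b + 4).+2) set0; last by apply: at_leaf; lia.
have [||x xP] := path_gadget _ _ o1 o2 o3; try lia.
by exists x; apply: local_gadget_widen xP; lia.
Qed.

(** A longer path contains 2m + 1 disjoint blocks of nine consecutive depths. At most m are bad, by
    their distinct twin supports, and at most m are good, by their gadgets. *)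
Lemma depth_bound : d w < 9 * (2 * m + 1).
Proof.
rewrite ltnNge; apply/negP => le_w.
set N := 2 * m + 1 in le_w.
pose B := [set j : 'I_N | bad_block (9 * j).+1 (9 * j + 8)].
have in_block (j : 'I_N) : 9 * j + 8 < d w by have := ltn_ord j; lia.
have cardB : #|B| <= m.
  apply: leq_trans card_twin_support.
  pose Q (j : 'I_N) s := [&& twin_support s, desc (a (9 * j).+1) s & ~~ desc (a (9 * j + 8)) s].
  pose f j := odflt r [pick s | Q j s].
  have fP j : j \in B -> Q j (f j).
    rewrite inE => /existsP[s sP]; rewrite /f.
    by case: pickP => // /(_ s); rewrite /Q sP.
  (* The twin support chosen for a bad block is not below the end of that block, hence not below the
     start of a later one. *)
  have f_lt j j' : j \in B -> j' \in B -> f j = f j' -> j' <= j.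
    move=> /fP/and3P[_ _ nd] /fP/and3P[_ dj' _] E; rewrite leqNgt; apply: contra nd => jj.
    rewrite E; apply: desc_trans dj'; apply: ancestor_desc.
    by have := in_block j'; lia.
  have f_inj : {in B &, injective f}.
    by move=> j j' jB jB' E; apply/val_inj/eqP; rewrite eqn_leq /= !f_lt.
  rewrite -(card_in_imset f_inj); apply: subset_leq_card.
  by apply/subsetP => _ /imsetP[j jB ->]; rewrite inE; case/and3P: (fP j jB).
pose I : finType := {j : 'I_N | j \in ~: B}.
have exg (i : I) : exists x, local_gadget (9 * val i) (9 * val i + 8) x.
  apply: block_gadget; first exact/ltnW/in_block.
  by have := valP i; rewrite !inE.
have [x xP] := fin_all_exists exg.
have disj (i j : I) v : i != j ->
    ~~ ((9 * val i <= d v <= 9 * val i + 8) && (9 * val j <= d v <= 9 * val j + 8)).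
  by rewrite -!val_eqE /=; lia.
have : #|I| <= m.
  apply: (@card_le_num_eigenvalues _ _ x) => [i j v ij|i j v ij|i]; last by case: (xP i).
    apply/eqP; rewrite mulf_eq0 -[_ || _]negbK negb_or; apply: contra (disj i j v ij).
    by have [xi _ _] := xP i; have [xj _ _] := xP j; move=> /andP[/xi-> /xj->].
  apply/eqP; rewrite mulf_eq0 -[_ || _]negbK negb_or; apply: contra (disj i j v ij).
  by have [_ xi _] := xP i; have [_ xj _] := xP j; move=> /andP[/xi-> /xj->].
rewrite card_sig (eq_card (B := ~: B)) // => cardCB.
by have := leq_add cardB cardCB; rewrite cardsC card_ord /N; lia.
Qed.

End LongPath.

(** * Bounding the order level by level *)

Lemma card_level n : reduced G -> #|[set v | d v == n]| <= (3 * m + 1) ^ n.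
Proof.
move=> redG; elim: n => [|n IHn].
  apply: leq_trans (_ : #|[set r]| <= _); last by rewrite cards1 expn0.
  apply: subset_leq_card; apply/subsetP => v; rewrite !inE => /eqP dv.
  have [_ _ dE _] := rootG.
  by apply: contraT => /dE; rewrite dv.
have sub : [set v | d v == n.+1] \subset \bigcup_(u in [set u | d u == n]) children u.
  apply/subsetP => v; rewrite inE => /eqP dv.
  have vp : v \in children (p v) by rewrite inE eqxx depth_gt0 // dv.
  by apply/bigcupP; exists (p v) => //; rewrite inE; have := depth_child vp; lia.
apply: leq_trans (subset_leq_card sub) _.
apply: leq_trans (leq_card_bigcup _ _) _.
apply: leq_trans (_ : \sum_(u in [set u | d u == n]) (3 * m + 1) <= _).
  by apply: leq_sum => u _; apply: card_children.
by rewrite sum_nat_const expnSr leq_mul2r IHn orbT.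
Qed.

Lemma card_rooted_tree : reduced G ->
  #|G| <= \sum_(i < 9 * (2 * m + 1)) (3 * m + 1) ^ i.
Proof.
move=> redG; rewrite -cardsT.
have sub : [set: G] \subset \bigcup_(i < 9 * (2 * m + 1)) [set v | d v == i].
  apply/subsetP => v _; apply/bigcupP.
  by exists (Ordinal (depth_bound v redG)); rewrite ?inE.
apply: leq_trans (subset_leq_card sub) _; apply: leq_trans (leq_card_bigcup _ _) _.
by apply: leq_sum => i _; apply: card_level.
Qed.

End RootedTree.

(** * Finiteness of the graphs of bounded order *)

Section BoundedGraphs.
Local Open Scope nat_scope.
Variables (n : nat) (E : {set 'I_n * 'I_n}).

(** Symmetrized and freed of loops, so that every set of pairs codes a graph. *)
Definition edges_adj : rel 'I_n :=
  fun i j => (i != j) && (((i, j) \in E) || ((j, i) \in E)).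

Lemma edges_adj_sym : symmetric edges_adj.
Proof. by move=> i j; rewrite /edges_adj eq_sym orbC. Qed.

Lemma edges_adj_irrefl : irreflexive edges_adj.
Proof. by move=> i; rewrite /edges_adj eqxx. Qed.

Definition edges_graph : sgraph := SGraph edges_adj_sym edges_adj_irrefl.
End BoundedGraphs.

(** The codes, consisting of an order below [N] and a set of pairs of vertex numbers, form a finite
    type; enumerating the vertices of a graph yields its code. *)
Lemma finitely_many_bounded (P : sgraph -> Prop) (N : nat) :
  (forall G, P G -> #|G| < N) -> finitely_many_upto_iso P.
Proof.
move=> bound; pose C : finType := {n : 'I_N & {set 'I_n * 'I_n}}.
exists #|C|, (fun i => edges_graph (tagged (enum_val i : C))) => G PG.
pose E : {set 'I_#|G| * 'I_#|G|} := [set ij | adj (enum_val ij.1) (enum_val ij.2)].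
pose c : C := @Tagged _ (Ordinal (bound G PG)) (fun n : 'I_N => {set 'I_n * 'I_n}) E.
exists (enum_rank c); rewrite enum_rankK /=.
exists (@enum_rank G); first exact: enum_rank_bij.
move=> x y; rewrite /= /edges_adj !inE /= !enum_rankK (inj_eq enum_rank_inj).
rewrite (adj_sym y) orbb; case: eqVneq => //= ->; exact/esym/adj_irrefl.
Qed.

Theorem theorem2p7 (k : nat) :
  finitely_many_upto_iso (fun T : sgraph =>
    [/\ is_tree T, reduced T & num_eigenvalues_open T (-1)%R 1%R = k]).
Proof.
(* The sum runs over the depths, with at most [3 * k + 1] children per vertex; the successor makes
   the bound strict. *)
apply: (@finitely_many_bounded _ (\sum_(i < 9 * (2 * k + 1)) (3 * k + 1) ^ i).+1).
move=> T [treeT redT mk]; have [[/card_gt0P[r _] _] _] := treeT.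
have [p [d rootT]] := tree_rooting r treeT.
by rewrite ltnS -mk; apply: (card_rooted_tree rootT).
Qed.
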